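(* Let $m,k\ge1$ with $m>1$, $q=2^{km}$, $d=2^m$, $n=(q+1)(d-1)$, $N=(q-1)/(d-1)$, $r=q^2$, $\alpha$ a generator of $\mathrm{GF}(r)^*$, $\beta=\alpha^N$, $\mathrm{Tr}$ the trace from $\mathrm{GF}(r)$ to $\mathrm{GF}(q)$, $\mathbf{c}_a=(\mathrm{Tr}(a\beta^0),\dots,\mathrm{Tr}(a\beta^{n-1}))$, and let $\overline{\mathcal{C}}$ be the extended code (appending the coordinate $-\sum_i c_i$ to each codeword $(c_0,\dots,c_{n-1})$) of $\{\mathbf{c}_a+b\mathbf{1}:a\in\mathrm{GF}(r),b\in\mathrm{GF}(q)\}$, $\mathbf{1}$ the all-one vector of length $n$. Then the supports of the codewords of weight $3$ in the dual code $\overline{\mathcal{C}}^\perp$ form a $2$-$(n+1,3,d-2)$ design.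
   Context: The support of a codeword is the set of its nonzero coordinate positions; a $2$-$(v,k,\lambda)$ design is a collection of $k$-subsets (blocks) of a $v$-set such that every pair of points lies in exactly $\lambda$ blocks. *)

(* Defs.v *)
From mathcomp Require Import all_boot all_order all_algebra all_fingroup.
From mathcomp Require Import all_solvable all_field.

Set Implicit Arguments.
Unset Strict Implicit.
Unset Printing Implicit Defensive.

Import GRing.Theory.
Local Open Scope ring_scope.

Section FieldTrace.
Variables (F : finFieldType) (L : fieldExtType F).

Lemma ex_trace (x : finvect_type L) :
  exists c : F, c%:A == galTrace 1%AS {: finvect_type L}%AS x.
Proof.
have gal1 : galois 1%AS {: finvect_type L}%AS.
  by apply: finField_galois; apply: sub1v.
have /vlineP[c ->] := mem_galTrace gal1 (memvf x).
by exists c; rewrite eqxx.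
Qed.

(* galTrace has values in L; they lie in the subfield F * 1, and trace returns
   the corresponding element of the base field F (see traceE). The type
   finvect_type L is L itself, equipped with its finite and splitting field
   structures over F. *)
Definition trace (x : finvect_type L) : F := xchoose (ex_trace x).

Lemma traceE (x : finvect_type L) :
  (trace x)%:A = galTrace 1%AS {: finvect_type L}%AS x.
Proof. exact/eqP/(xchooseP (ex_trace x)). Qed.

Definition trace_word (beta : finvect_type L) (n : nat) (a : finvect_type L) :
  'rV[F]_n := \row_(i < n) trace (a * beta ^+ i).

Definition trace_code (beta : finvect_type L) (n : nat) : {set 'rV[F]_n} :=
  [set trace_word beta n a + const_mx b | a : finvect_type L, b : F].

End FieldTrace.

Section Codes.
Variables (F : finFieldType) (n : nat).

Definition extend_word (c : 'rV[F]_n) : 'rV[F]_(n + 1) :=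
  row_mx c (const_mx (- \sum_i c 0 i)).

Definition extended_code (C : {set 'rV[F]_n}) : {set 'rV[F]_(n + 1)} :=
  [set extend_word c | c in C].

Definition dual_code (C : {set 'rV[F]_n}) : {set 'rV[F]_n} :=
  [set v : 'rV[F]_n | [forall (c | c \in C), \sum_i v 0 i * c 0 i == 0]].

Definition word_support (c : 'rV[F]_n) : {set 'I_n} := [set i | c 0 i != 0].

Definition weight (c : 'rV[F]_n) : nat := #|word_support c|.

Definition supports_of_weight (w : nat) (C : {set 'rV[F]_n}) : {set {set 'I_n}} :=
  [set word_support c | c in C & weight c == w].

End Codes.

(* The points are all the elements of T. The blocks form a set, so that the
   words with a common support contribute a single block. *)
Definition is_2design (T : finType) (v k lambda : nat) (B : {set {set T}}) : Prop :=
  [/\ #|T| = v,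
      forall b : {set T}, b \in B -> #|b| = k
    & forall x y : T, x != y ->
        #|[set b in B | (x \in b) && (y \in b)]| = lambda].

(* Main.v *)
(* Up to the extra coordinate, which is the evaluation at 0, the extended code
   consists of the evaluations of the maps z |-> Tr(a z) + b on the n-th roots of
   unity together with 0. Hence a weight-3 dual word is an affine dependency
   between three of these points, and its support is a triple of points of P on a
   common line of the affine plane GF(q^2) over GF(q), where P is the set of the
   z with z^(q+1) in GF(d). This P is Denniston's maximal arc: restricted to a
   line, the form z^(q+1) is a polynomial C + B t + A t^2. On a line through 0 we
   have B = 0, and the values in GF(d) are easily counted; on the other lines
   the form has no zero, so C is not in the image of the additive map
   t |-> B t + A t^2, which therefore meets GF(d) in a subgroup of index 2. In
   both cases a line meeting P in two points meets it in exactly d points. Two points of P thus lie on d - 2 collinear triples. *)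

From HB Require Import structures.
Require Import Defs.
From mathcomp Require Import all_boot all_order all_algebra all_fingroup.
From mathcomp Require Import all_solvable all_field.
From mathcomp Require Import ring zify.

Set Implicit Arguments.
Unset Strict Implicit.
Unset Printing Implicit Defensive.

Import GRing.Theory.
Local Open Scope ring_scope.

(** * Counting solutions of equations in a finite field *)

Lemma finField_prim_root (K : finFieldType) :
  exists z : K, (#|K|.-1).-primitive_root z.
Proof.
have K_gt1 : (1 < #|K|)%N := finNzRing_gt1 K.
have szK : size [seq x <- enum K | x != 0] = #|K|.-1.
  rewrite -(cardC1 (0 : K)) cardE; congr (size _).
  by rewrite /enum_mem -filter_predI; apply: eq_filter => x; rewrite !inE andbT.
have [||||z _ zP] := hasP (@has_prim_root K #|K|.-1 [seq x <- enum K | x != 0] _ _ _ _).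
- by rewrite -subn1 subn_gt0.
- apply/allP=> x; rewrite mem_filter unity_rootE => /andP[x0 _].
  by rewrite -(inj_eq (mulfI x0)) mulr1 -exprS prednK ?expf_card // ltnW.
- by rewrite filter_uniq // enum_uniq.
- by rewrite szK.
- by exists z.
Qed.

(** The solutions are 0 and the [d.-1]-th roots of unity, all of which lie in [K] because [d.-1]
    divides the order of the cyclic group of units. For [d] a power of 2 in characteristic 2 they
    form the subfield GF(d). *)
Lemma card_fixed_expn (K : finFieldType) (d : nat) :
  (1 < d)%N -> (d.-1 %| #|K|.-1)%N -> #|[set c : K | c ^+ d == c]| = d.
Proof.
move=> d_gt1 dvd_d; have [z0 /dvdn_prim_root /(_ _ dvd_d) zP] := finField_prim_root K.
set z := z0 ^+ _ in zP; have d_gt0 : (0 < d)%N by apply: ltnW.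
have z_neq0 : z != 0.
  apply: contra_eq_neq (prim_expr_order zP) => ->.
  by rewrite expr0n gtn_eqF ?(prim_order_gt0 zP) // eq_sym oner_neq0.
have -> : [set c : K | c ^+ d == c] = 0 |: [set z ^+ (i : 'I_d.-1) | i : 'I_d.-1].
  apply/setP=> c; rewrite !inE -[d in LHS]prednK // exprS.
  have [->|c0] := eqVneq c 0; first by rewrite mul0r eqxx.
  rewrite -[X in _ == X]mulr1 (inj_eq (mulfI c0)) /=.
  apply/eqP/imsetP => [/(prim_rootP zP)[i ->]|[i _ ->]]; first by exists i.
  by rewrite exprAC (prim_expr_order zP) expr1n.
rewrite cardsU1 card_imset ?card_ord.
  case: imsetP => [[i _ /esym/eqP]|_]; last by rewrite add1n prednK.
  by rewrite expf_eq0 (negPf z_neq0) andbF.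
move=> i j /eqP; rewrite (eq_prim_root_expr zP) !modn_small // => /eqP.
exact: val_inj.
Qed.

(* B = 0 would make c0 a value, so the additive map t |-> B t + A t^2 has a kernel
   of order 2 and its image H has index 2; as c0 lies outside H, each pair
   {c, c + c0} meets H exactly once. *)
Lemma card_quadratic_preim (K : finFieldType) (A B c0 : K) (D : {set K}) :
    2%N \in [pchar K] -> A != 0 -> (forall c, c \in D -> c + c0 \in D) ->
    (forall t, B * t + A * t ^+ 2 != c0) ->
  #|[set t | B * t + A * t ^+ 2 \in D]| = #|D|.
Proof.
move=> char2 A0 Dc0 imf; have K2 : 2%:R = 0 :> K by apply: pcharf0.
pose f t := B * t + A * t ^+ 2; pose fib (c : K) := #|[set t | f t == c]|.
have fib_sum (P : pred K) : (\sum_(c | P c) fib c = #|[set t | P (f t)]|)%N.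
  rewrite -sum1_card [RHS](partition_big f P) => [|t]; last by rewrite inE.
  apply: eq_bigr => c Pc; rewrite /fib -sum1_card; apply: eq_bigl => t.
  by rewrite !inE; case: eqP => [->|]; rewrite ?Pc ?andbF.
have addcK c : c + c0 + c0 = c by rewrite -addrA -mulr2n -mulr_natr K2 mulr0 addr0.
have fib2 (c : K) : (fib c <= 2)%N.
  have [->//|] := posnP (fib c); rewrite card_gt0 => /set0Pn[t].
  rewrite inE => /eqP ftc.
  (* Two distinct roots of A t^2 + B t = c sum to -B/A. *)
  apply: (@leq_trans #|[set t; - (B / A) - t]|); last by rewrite cards2; case: (_ != _).
  apply/subset_leq_card/subsetP => u; rewrite !inE => /eqP fuc.
  have: (u - t) * (u + t + B / A) * A = 0.
    transitivity (f u - f t); last by rewrite fuc ftc subrr.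
    by rewrite /f; field.
  move/eqP; rewrite !mulf_eq0 (negPf A0) orbF subr_eq0 => /orP[->//|].
  by rewrite -addrA addr_eq0 opprD addrC => ->; rewrite orbT.
have fib_pair (c : K) : (fib c + fib (c + c0)%R <= 2)%N.
  have [-> | ] := posnP (fib c); first by rewrite add0n.
  rewrite card_gt0 => /set0Pn[t]; rewrite inE => /eqP ftc.
  suff -> : fib (c + c0)%R = 0%N by rewrite addn0.
  apply/eqP; rewrite cards_eq0; apply/eqP/setP => u; rewrite !inE.
  (* In characteristic 2, [f (u - t)] equals [f u - f t], which would be the excluded value [c0];
     the multiple of [2%:R] below is the discrepancy. *)
  apply: contraNF (imf (u - t)) => /eqP fuc; rewrite -[eqbRHS](addKr c) -fuc -ftc.
  apply/eqP; transitivity (f u - f t + (A * t ^+ 2 - A * t * u) * 2%:R).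
    by rewrite /f; ring.
  by rewrite K2 mulr0 addr0 addrC.
have shift (P : pred K) : (forall c, P (c + c0) = P c) ->
    (\sum_(c | P c) fib (c + c0)%R = \sum_(c | P c) fib c)%N.
  move=> Pc0; rewrite [RHS](reindex_inj (addIr c0)).
  by apply: eq_bigl => c; rewrite Pc0.
have fib_pairE (c : K) : (fib c + fib (c + c0)%R = 2)%N.
  (* The fibres partition [K], and so do the shifted ones. Summed over all [c], the bound thus has
     the same value on both sides, so it is sharp at every [c]. *)
  have := leqif_sum (fun (c : K) (_ : true) => leqif_eq (fib_pair c)).
  rewrite big_split /= shift // fib_sum cardsT sum_nat_const.
  case=> _; rewrite addnn -muln2 eqxx => /esym/forallP/(_ c).
  by move/eqP.
(* As [D] is stable under the shift by [c0], twice the count is the sum over [D] of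
   [fib c + fib (c + c0)], each term being 2. *)
apply/eqP; rewrite -(eqn_pmul2r (isT : 0 < 2)%N) muln2 -addnn.
rewrite -[#|[set t | _]|](fib_sum (mem D)) -{2}shift ?big_split //=.
  rewrite -big_split /=; under eq_bigr do rewrite fib_pairE.
  by rewrite sum_nat_const.
move=> c; apply/idP/idP => [/Dc0|/Dc0 //].
by rewrite addcK.
Qed.

(** * Linearity and nondegeneracy of the trace *)

Section Trace.
Variables (F : finFieldType) (L : fieldExtType F).
Implicit Types x y a : finvect_type L.

Lemma trace_is_linear : scalar (@trace F L).
Proof.
move=> c x y; apply: (fmorph_inj (in_alg (finvect_type L))) => /=.
rewrite traceE -mulr_algl scalerDl -scalerA !traceE.
have -> : c *: galTrace 1%AS {: finvect_type L}%AS x =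
    galTrace 1%AS {: finvect_type L}%AS (c *: x).
  by rewrite /galTrace scaler_sumr; apply: eq_bigr => g _; rewrite linearZ.
by rewrite raddfD mulr1.
Qed.

HB.instance Definition _ :=
  GRing.isLinear.Build F (finvect_type L) F *%R (@trace F L) trace_is_linear.

(** Dedekind independence: the combination of the automorphisms g with coefficients g(y) vanishes at
    every a, so all g(y) are 0, in particular the one for g = 1. *)
Lemma trace_eq0 y : (forall a, trace (a * y) = 0) -> y = 0.
Proof.
move=> try0; rewrite -[y](gal_id {: finvect_type L}%AS).
apply: (@gal_independent F (finvect_type L) {: finvect_type L}%AS
  [in 'Gal({: finvect_type L} / 1)%g] (fun g => g y)); last exact: group1.
move=> a _; transitivity (galTrace 1%AS {: finvect_type L}%AS (a * y)).
  by apply: eq_bigr => g _; rewrite rmorphM mulrC.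
by rewrite -traceE try0 scale0r.
Qed.

End Trace.

(** * Weight-3 words and collinear triples *)

Lemma sum_triple (U : zmodType) (I : finType) (f : I -> U) (x y z : I) :
    x != y -> z != x -> z != y ->
    (forall i, i \notin [set x; y; z] -> f i = 0) ->
  \sum_i f i = f x + f y + f z.
Proof.
move=> xy zx zy f0; rewrite (bigD1 x) //= (bigD1 y) ?(eq_sym y) //=.
rewrite (bigD1 z) ?zx //= big1 ?addr0 ?addrA // => i /andP[/andP[ix iy] iz].
by apply: f0; rewrite !inE !negb_or ix iy iz.
Qed.

Section Collinear.
Variables (F : finFieldType) (V : lmodType F) (n : nat) (pt : 'I_n -> V).
Variables (C : {set 'rV[F]_n}) (pt_inj : injective pt).
Hypothesis CP : forall v : 'rV[F]_n,
  reflect (\sum_i v 0 i = 0 /\ \sum_i v 0 i *: pt i = 0) (v \in C).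

Let third (x y : 'I_n) := [set z | [&& z != x, z != y &
  [exists t, pt z == pt x + t *: (pt y - pt x)]]].

(** Up to scaling, three nonzero coefficients with sum 0 are 1 - t, t, -1, and the vector relation
    then puts the third point on the line through the other two. *)
Lemma supports_of_weight3_third (x y : 'I_n) : x != y ->
  [set b in supports_of_weight 3 C | (x \in b) && (y \in b)] =
  [set [set x; y; z] | z in third x y].
Proof.
move=> xy; apply/setP=> b; rewrite !inE; apply/idP/imsetP.
  case/andP=> /imsetP[v]; rewrite inE => /andP[/CP[v0 vpt0] /eqP wv] -> /andP[xv yv].
  have: #|word_support v :\ x :\ y| == 1%N.
    move: wv; rewrite /weight (cardsD1 x) xv (cardsD1 y) !inE eq_sym xy /=.
    by move: yv; rewrite inE => -> /eqP.
  move/cards1P=> [z vz].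
  have vE : word_support v = [set x; y; z].
    rewrite -(setD1K xv) -(setD1K (_ : y \in word_support v :\ x)) ?vz ?setUA //.
    by rewrite !inE eq_sym xy; rewrite inE in yv.
  have /setD1P[zy /setD1P[zx]] : z \in word_support v :\ x :\ y by rewrite vz set11.
  rewrite inE => nz_vz.
  have v_out i : i \notin [set x; y; z] -> v 0 i = 0.
    by rewrite -vE inE negbK => /eqP.
  move: v0 vpt0; rewrite !(@sum_triple _ _ _ x y z) // => [v0 vpt0|i /v_out->];
    last by rewrite scale0r.
  (* Subtracting (v_x + v_y + v_z) [pt x], which is 0, from the relation leaves v_y ([pt y - pt x])
     + v_z ([pt z - pt x]) = 0; this gives the parameter. *)
  exists z => //; rewrite inE zx zy /=; apply/existsP; exists (- (v 0 y / v 0 z)).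
  rewrite -(inj_eq (scalerI nz_vz)) scalerDr scalerA mulrN mulrCA divff // mulr1.
  rewrite -subr_eq0 scaleNr scalerBr; apply/eqP.
  transitivity (v 0 x *: pt x + v 0 y *: pt y + v 0 z *: pt z
     - (v 0 x + v 0 y + v 0 z) *: pt x); last by rewrite v0 vpt0 scale0r subr0.
  rewrite !scalerDl !opprD !opprK !addrA.
  by rewrite [RHS](ACl (2*3*5*6*(1*4))) [LHS](ACl (3*1*4*2)) /= subrr addr0.
case=> z; rewrite inE => /and3P[zx zy /existsP[t /eqP zt]] ->.
rewrite !inE !eqxx orbT !andbT /=.
pose v : 'rV[F]_n := \row_i
  if i == x then 1 - t else if i == y then t else if i == z then -1 else 0.
have vx : v 0 x = 1 - t by rewrite mxE eqxx.
have vy : v 0 y = t by rewrite mxE eqxx eq_sym (negPf xy).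
have vz : v 0 z = -1 by rewrite mxE eqxx (negPf zx) (negPf zy).
have v_out i : i \notin [set x; y; z] -> v 0 i = 0.
  by rewrite !inE !negb_or -andbA mxE => /and3P[/negPf-> /negPf-> /negPf->].
have t0 : t != 0.
  by apply: contraNneq zx => t0; apply/eqP/pt_inj; rewrite zt t0 scale0r addr0.
have t1 : 1 - t != 0.
  rewrite subr_eq0 eq_sym; apply: contraNneq zy => t1.
  by apply/eqP/pt_inj; rewrite zt t1 scale1r addrC subrK.
have vE : word_support v = [set x; y; z].
  apply/setP=> i; rewrite inE; have [|/v_out->] := boolP (i \in _); last by rewrite eqxx.
  by rewrite !inE -orbA => /or3P[] /eqP->; rewrite ?vx ?vy ?vz ?oppr_eq0 ?oner_eq0.
apply/imsetP; exists v => //; rewrite inE /weight vE.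
rewrite [[set x; y; z]]setUC cardsU1 cards2 xy !inE negb_or zx zy /= eqxx andbT.
apply/CP; split.
  by rewrite (@sum_triple _ _ _ x y z) // vx vy vz subrK subrr.
rewrite (@sum_triple _ _ _ x y z) // => [|i /v_out->]; last by rewrite scale0r.
rewrite vx vy vz zt scaleN1r scalerBl scalerBr scale1r.
by rewrite -[_ - _ + _]addrA [- _ + _]addrC subrr.
Qed.

(** Third points correspond to the parameters of arc points on the line, except t = 0 and t = 1,
    which give [x] and [y]; both always occur, so the subtraction is exact. *)
Lemma card_supports_of_weight3 (x y : 'I_n) : x != y ->
  #|[set b in supports_of_weight 3 C | (x \in b) && (y \in b)]| =
  (#|[set t : F | [exists i, pt i == pt x + t *: (pt y - pt x)]]%R| - 2)%N.
Proof.
move=> xy; rewrite supports_of_weight3_third // card_in_imset; last first.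
  move=> z w; rewrite !inE => /and3P[zx zy _] /and3P[wx wy _] /setP/(_ z).
  by rewrite !inE (negPf zx) (negPf zy) eqxx /= => /esym/eqP.
have yx0 : pt y - pt x != 0 by rewrite subr_eq0 (inj_eq pt_inj) eq_sym.
have line_inj : injective (fun t => pt x + t *: (pt y - pt x)).
  by move=> t u /addrI/eqP; rewrite -subr_eq0 -scalerBl scaler_eq0 (negPf yx0) orbF subr_eq0 => /eqP.
set T := [set t | _].
have T0 : 0 \in T by rewrite inE; apply/existsP; exists x; rewrite scale0r addr0.
have T1 : 1 \in T :\ 0.
  rewrite !inE oner_eq0; apply/existsP; exists y.
  by rewrite scale1r addrC subrK.
rewrite (cardsD1 0) T0 (cardsD1 1) T1 addnA addKn.
(* The index of the point at parameter [t]; [None] occurs only outside [T]. *)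
pose f t : option 'I_n := [pick i | pt i == pt x + t *: (pt y - pt x)].
rewrite -(card_imset _ Some_inj) -(@card_in_imset _ _ f); last first.
  move=> t u; rewrite !inE => /and3P[_ _ /existsP[i /eqP it]] /and3P[_ _ /existsP[j /eqP ju]].
  rewrite /f; case: pickP => [k /eqP kt|/(_ i)]; last by rewrite it eqxx.
  case: pickP => [l /eqP lt|/(_ j)]; last by rewrite ju eqxx.
  by case=> kl; apply: line_inj; rewrite -kt -lt kl.
apply: eq_card => o; apply/imsetP/imsetP => [[z zt ->]|[t]].
  move: zt; rewrite inE => /and3P[zx zy /existsP[t /eqP zt]].
  exists t.
    rewrite !inE; apply/and3P; split.
    - by apply: contraNneq zy => t1; apply/eqP/pt_inj; rewrite zt t1 scale1r addrC subrK.
    - by apply: contraNneq zx => t0; apply/eqP/pt_inj; rewrite zt t0 scale0r addr0.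
    - by apply/existsP; exists z; rewrite zt.
  rewrite /f; case: pickP => [k /eqP kt|/(_ z)]; last by rewrite zt eqxx.
  by congr Some; apply: pt_inj; rewrite zt kt.
rewrite !inE => /and3P[t1 t0 /existsP[z /eqP zt]] ->.
exists z; last first.
  rewrite /f; case: pickP => [k /eqP kt|/(_ z)]; last by rewrite zt eqxx.
  by congr Some; apply: pt_inj; rewrite zt kt.
rewrite inE; apply/and3P; split; last by apply/existsP; exists t; rewrite zt.
- apply: contraNneq t0 => zx; apply/eqP/line_inj.
  by rewrite -zt zx scale0r addr0.
- apply: contraNneq t1 => zy; apply/eqP/line_inj.
  by rewrite -zt zy scale1r addrC subrK.
Qed.

End Collinear.

(** * Line intersections of Denniston's maximal arc *)

Section DennistonArc.
Variables (F : finFieldType) (L : fieldExtType F) (e m : nat).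
Hypothesis cardF : #|F| = (2 ^ e)%N.
Hypothesis cardL : #|finvect_type L| = (#|F| ^ 2)%N.
Hypothesis m_gt0 : (0 < m)%N.

Local Notation q := #|F|.
Local Notation d := (2 ^ m)%N.
Hypothesis dvd_d : (d.-1 %| q.-1)%N.

Let char2 : 2%N \in [pchar F].
Proof. exact: card_finPcharP cardF _. Qed.

Implicit Types X W z : finvect_type L.

(** When [L] has degree 2, [z ^+ q.+1] is the norm of [z] to [F]; the equation says that it lies in
    GF(d). *)
Definition arc z := (z ^+ q.+1) ^+ d == z ^+ q.+1.

Let subfield_elt z : z ^+ q = z -> exists c : F, z = c%:A.
Proof.
move=> zq; have : z \in 1%AS.
  by rewrite Fermat's_little_theorem dimv1 expn1 zq.
by move=> /vlineP[c ->]; exists c.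
Qed.

Let char2L : 2%N \in [pchar finvect_type L].
Proof. by rewrite (fmorph_pchar (in_alg (finvect_type L))). Qed.

Let frobD X W : (X + W) ^+ q = X ^+ q + W ^+ q.
Proof. by apply: exprDn_pchar; rewrite cardF (eq_pnat _ (pcharf_eq char2L)) pnatX pnat_id. Qed.

Let expq2 z : (z ^+ q) ^+ q = z.
Proof. by rewrite -exprM mulnn -cardL expf_card. Qed.

Let alg_inj : injective (fun c : F => c%:A : finvect_type L).
Proof. exact: (fmorph_inj (in_alg (finvect_type L))). Qed.

Lemma card_arc_line X W : W != 0 -> arc X -> arc (X + W) ->
  #|[set t : F | arc (X + t *: W)]| = d.
Proof.
move=> W0 arcX arcXW.
have [C CE] : exists C : F, X ^+ q.+1 = C%:A.
  by apply: subfield_elt; rewrite exprS exprMn expq2 mulrC.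
have [A AE] : exists A : F, W ^+ q.+1 = A%:A.
  by apply: subfield_elt; rewrite exprS exprMn expq2 mulrC.
have [B BE] : exists B : F, X ^+ q * W + X * W ^+ q = B%:A.
  by apply: subfield_elt; rewrite frobD !exprMn !expq2 addrC.
pose D := [set c : F | c ^+ d == c].
have cardD : #|D| = d by apply: card_fixed_expn => //; rewrite -{1}(expn0 2) ltn_exp2l.
have normE t : (X + t *: W) ^+ q.+1 = (C + (B * t + A * t ^+ 2))%:A.
  rewrite !scalerDl -CE [B * t]mulrC [A * _]mulrC -!scalerA -BE -AE.
  rewrite (exprS (_ + _)) (exprS X) (exprS W) frobD exprZn expf_card.
  rewrite -(mulr_algl t W) -(mulr_algl t (W ^+ q)) -(mulr_algl t (_ + _)).
  rewrite -(mulr_algl t (W * _)) -(mulr_algl t (_ * _)).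
  move: (X ^+ q) (W ^+ q) (t%:A) => Xq Wq u. ring.
have arcE t : arc (X + t *: W) = (C + (B * t + A * t ^+ 2) \in D).
  by rewrite /arc normE -(rmorphXn (in_alg (finvect_type L))) (inj_eq alg_inj) inE.
have DD a b : a \in D -> b \in D -> a + b \in D.
  rewrite !inE => /eqP aD /eqP bD; rewrite exprDn_pchar ?aD ?bD //.
  by rewrite (eq_pnat _ (pcharf_eq char2)) pnatX pnat_id.
have addcc := addrr_pchar2 char2.
have CD : C \in D.
  by have := arcE 0; rewrite scale0r addr0 arcX expr0n !mulr0 !addr0 => <-.
have DC c : (C + c \in D) = (c \in D).
  apply/idP/idP => [/(DD _ _ CD)|/(DD _ _ CD) //].
  by rewrite addrA addcc add0r.
have ABD : B + A \in D.
  by have := arcE 1; rewrite scale1r arcXW expr1n !mulr1 DC.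
have A0 : A != 0.
  apply: contraNneq W0 => A0; move: AE; rewrite A0 scale0r => /eqP.
  by rewrite expf_eq0.
under eq_finset do rewrite arcE DC.
(* If B = 0, then A lies in [D] and the condition becomes t^2 in [D]; squaring is injective, so this
   means t in [D]. *)
have [B0|B0] := eqVneq B 0.
  rewrite -[RHS]cardD; apply: eq_card => t; rewrite !inE B0 mul0r add0r.
  move: ABD; rewrite B0 add0r inE => /eqP AD.
  rewrite exprMn AD (inj_eq (mulfI A0)) exprAC -subr_eq0.
  have -> : (t ^+ d) ^+ 2 - t ^+ 2 = (t ^+ d - t) ^+ 2.
    by rewrite subr_sqr !(GRing.subr_pchar2 char2).
  by rewrite expf_eq0 subr_eq0.
rewrite (card_quadratic_preim (c0 := C)) // => [c /DD ->//|t].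
(* The value C would make the norm of X + t W vanish, so X = t W; both summands of B are then t
   W^(q+1), and they cancel. *)
apply: contraNneq B0 => Ct.
have XtW : X + t *: W = 0.
  by apply/eqP; have := normE t; rewrite Ct addcc scale0r => /eqP; rewrite expf_eq0.
have XE : X = t *: W.
  by move/eqP: XtW; rewrite addr_eq0 (oppr_pchar2 char2L) => /eqP.
apply/eqP/alg_inj; rewrite -BE XE exprZn expf_card scale0r.
by rewrite -!scalerAl [W * _]mulrC (addrr_pchar2 char2L).
Qed.

End DennistonArc.

(** * The dual of the extended trace code *)

Section DualCode.
Variables (F : finFieldType) (L : fieldExtType F).

(** Pairing [v] with a codeword gives Tr(a S) + b s, where S is the weighted sum of the points and s
    the sum of the entries. Taking a = 0 isolates s, and nondegeneracy of the trace then kills S. *)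
Lemma dual_trace_codeP n (pt : 'I_n -> finvect_type L) (C : {set 'rV[F]_n}) :
    (forall c, reflect (exists a b, c = \row_i (trace (a * pt i) + b)) (c \in C)) ->
  forall v : 'rV[F]_n,
    reflect (\sum_i v 0 i = 0 /\ \sum_i v 0 i *: pt i = 0) (v \in dual_code C).
Proof.
move=> CP v.
have vE a b : \sum_i v 0 i * (\row_i (trace (a * pt i) + b)) 0 i =
    trace (a * \sum_i v 0 i *: pt i) + (\sum_i v 0 i) * b.
  rewrite mulr_sumr linear_sum mulr_suml -big_split /=.
  by apply: eq_bigr => i _; rewrite mxE mulrDr -scalerAr linearZ.
apply: (iffP idP) => [|[v0 vpt0]]; rewrite inE; last first.
  by apply/forallP=> c; apply/implyP=> /CP[a [b ->]]; rewrite vE v0 vpt0 mulr0 mul0r linear0 addr0.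
move=> /forallP vC.
have {}vC a b : trace (a * \sum_i v 0 i *: pt i) + (\sum_i v 0 i) * b = 0.
  rewrite -vE; apply/eqP; apply: (implyP (vC _)).
  by apply/CP; exists a, b.
split; first by have := vC 0 1; rewrite mul0r linear0 add0r mulr1.
by apply: trace_eq0 => a; have := vC a 0; rewrite mulr0 addr0.
Qed.

Variables (n : nat) (beta : finvect_type L).

Definition ext_point (i : 'I_(n + 1)) : finvect_type L :=
  if split i is inl j then beta ^+ j else 0.

Hypothesis beta_prim : n.-primitive_root beta.

Lemma ext_point_inj : injective ext_point.
Proof.
have beta_neq0 i : beta ^+ i != 0.
  rewrite expf_neq0 //; apply: contra_eq_neq (prim_expr_order beta_prim) => ->.
  by rewrite expr0n gtn_eqF ?(prim_order_gt0 beta_prim) // eq_sym oner_neq0.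
rewrite /ext_point => i j.
case: splitP => i' ii; case: splitP => j' jj.
- move/eqP; rewrite (eq_prim_root_expr beta_prim) !modn_small // => /eqP ij.
  by apply: val_inj; rewrite /= ii jj.
- by move/eqP; rewrite (negPf (beta_neq0 _)).
- by move/esym/eqP; rewrite (negPf (beta_neq0 _)).
- by move=> _; apply: val_inj; rewrite /= ii jj !ord1.
Qed.

Lemma ext_pointP (z : finvect_type L) :
  [exists i, ext_point i == z] = (z == 0) || (z ^+ n == 1).
Proof.
apply/existsP/orP => [[i /eqP<-]|].
  rewrite /ext_point; case: split => j; last by left.
  by right; rewrite exprAC (prim_expr_order beta_prim) expr1n.
case=> [/eqP->|/eqP/(prim_rootP beta_prim)[j ->]].
  by exists (rshift n ord0); rewrite /ext_point (unsplitK (inr _)).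
by exists (lshift 1 j); rewrite /ext_point (unsplitK (inl _)).
Qed.

(** The appended coordinate is the value b at 0: the powers of [beta] sum to 0, which removes the
    trace part, and -n b = b for n odd in characteristic 2. *)
Lemma extended_trace_codeP : (1 < n)%N -> odd n -> 2%N \in [pchar F] ->
  forall c, reflect (exists a b, c = \row_i (trace (a * ext_point i) + b))
    (c \in extended_code (trace_code beta n)).
Proof.
move=> n_gt1 n_odd char2 c.
have sum_beta : \sum_(i < n) beta ^+ i = 0.
  have /eqP := subrX1 beta n.
  rewrite (prim_expr_order beta_prim) subrr eq_sym mulf_eq0 => /orP[|/eqP//].
  by rewrite subr_eq0 -[beta]expr1 -(prim_order_dvd beta_prim) dvdn1 gtn_eqF.
have extE a b : extend_word (trace_word beta n a + const_mx b) =
    \row_i (trace (a * ext_point i) + b).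
  apply/rowP=> i; rewrite !mxE /ext_point; case: split => j; rewrite !mxE //.
  under eq_bigr do rewrite !mxE.
  rewrite big_split /= -linear_sum -mulr_sumr sum_beta !mulr0 !linear0 !add0r.
  rewrite sumr_const card_ord oppr_pchar2 // -{1}(odd_double_half n) n_odd.
  by rewrite mulrnDr -muln2 mulrnA mulr2n addrr_pchar2 // addr0.
apply: (iffP imsetP) => [[_ /imset2P[a b _ _ ->] ->]|[a [b ->]]].
  by exists a, b; rewrite extE.
by exists (trace_word beta n a + const_mx b); rewrite ?extE //; apply/imset2P; exists a b.
Qed.

End DualCode.

(** * The order of [beta] and the design *)

Lemma generator_prim_root (K : finFieldType) (a : {unit K}) :
  generator [set: {unit K}] a -> (#|K|.-1).-primitive_root (val a).
Proof.
rewrite /generator => /eqP gen_a.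
have oa : #[a]%g = #|K|.-1 by rewrite /order -gen_a card_finField_unit.
rewrite -oa; apply/andP; split; first exact: order_gt0.
apply/forallP=> i; rewrite unity_rootE -FinRing.val_unitX -FinRing.val_unit1.
rewrite (inj_eq val_inj) -order_dvdn; apply/eqP; apply/idP/eqP => [dvd_a|->//].
by apply/eqP; rewrite eqn_leq ltn_ord dvdn_leq.
Qed.

Local Close Scope ring_scope.

Theorem theorem9 (m k q d n N r : nat)
    (F : finFieldType) (L : fieldExtType F)
    (alpha : {unit finvect_type L}) (beta : finvect_type L)
    (hm : 1 < m) (hk : 1 <= k)
    (hq : q = 2 ^ (k * m)) (hd : d = 2 ^ m)
    (hn : n = (q + 1) * (d - 1)) (hN : N = (q - 1) %/ (d - 1))
    (hr : r = q ^ 2)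
    (hF : #|F| = q) (hL : #|finvect_type L| = r)
    (halpha : generator [set: {unit finvect_type L}] alpha)
    (hbeta : beta = (val alpha ^+ N)%R) :
  is_2design (n + 1) 3 (d - 2)
    (supports_of_weight 3 (dual_code (extended_code (trace_code beta n)))).
Proof.
have m_gt0 : 0 < m by apply: ltnW.
have d_ge4 : 4 <= d by rewrite hd -[4]/(2 ^ 2) leq_pexp2l.
have q_gt0 : 0 < q by rewrite hq expn_gt0.
have dvd_d : d.-1 %| q.-1 by rewrite hq hd mulnC expnM dvdn_pred_predX.
have q_gt1 : 1 < q.
  by rewrite hq -{1}(expn0 2) ltn_exp2l // muln_gt0 hk.
have n_gt1 : 1 < n by rewrite hn; nia.
have q_even : ~~ odd q by rewrite hq oddX orbF muln_eq0 negb_or -!lt0n hk m_gt0.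
have d_even : ~~ odd d by rewrite hd oddX orbF -lt0n m_gt0.
have n_odd : odd n.
  by rewrite hn oddM oddD (negPf q_even) oddB ?(negPf d_even) //; lia.
have char2 : (2 \in [pchar F])%R by apply: (card_finPcharP (n := k * m)); rewrite ?hF.
(* q^2 - 1 = (q - 1)(q + 1) = N (d - 1)(q + 1), so [beta] has order [n]. *)
have nN : r.-1 = N * n.
  move: dvd_d; rewrite hN hn -!subn1 => /divnK dN.
  by rewrite mulnCA dN hr -mulnn; nia.
have beta_prim : (n.-primitive_root beta)%R.
  have := dvdn_prim_root (generator_prim_root halpha); rewrite hL nN hbeta => /(_ n).
  by rewrite mulnK ?dvdn_mull // ?(ltnW n_gt1) //; apply.
have codeP := dual_trace_codeP (extended_trace_codeP beta_prim n_gt1 n_odd char2).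
split=> [|b /imsetP[v]|x y xy]; first by rewrite card_ord.
  by rewrite inE => /andP[_ /eqP wv] ->.
rewrite (card_supports_of_weight3 (ext_point_inj beta_prim) codeP xy); congr (_ - _).
(* For z nonzero, the norm lies in GF(d) iff its (d - 1)-th power, which is z^n, equals 1. *)
have arcP (z : finvect_type L) : [exists i : 'I_(n + 1), ext_point beta i == z] = arc m z.
  rewrite (ext_pointP beta_prim) /arc -hd hF.
  have d0 : 0 < d by apply: leq_trans d_ge4.
  have [->|z0] := eqVneq z 0%R; first by rewrite /= exprS mul0r expr0n (gtn_eqF d0) eqxx.
  rewrite -[d in RHS]prednK // exprS -[X in _ = (_ == X)]mulr1.
  by rewrite (inj_eq (mulfI (expf_neq0 _ z0))) -exprM hn addn1 subn1.
under eq_finset do rewrite arcP.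
have arc_pt (i : 'I_(n + 1)) : arc m (ext_point beta i) by rewrite -arcP; apply/existsP; exists i.
rewrite (card_arc_line (e := k * m)) -?hd ?hF ?hL //.
- by rewrite subr_eq0 (inj_eq (ext_point_inj beta_prim)) eq_sym.
- by rewrite addrC subrK.
Qed.
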